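(* Let $L\ge 1$ be an integer, $p\in(0,1)$, and let $(A_n)_{n\ge1}$ be the stationary distance sequence built from i.i.d. $L$-bit blocks with bit-parameter $p$ (see context). Put $w_r=p^r(1-p)^{L-r}$ for $0\le r\le L$. Then for all integers $n,k,i,j\ge 1$: $$\Pr[A_n=i]=\sum_{r=0}^{L}\binom{L}{r}w_r^2(1-w_r)^{i-1},$$ and $P_k(i,j):=\Pr[A_n=i,\,A_{n+k}=j]$ does not depend on $n$ and is given by: (1) if $1\le j\le k-1$: $P_k(i,j)=\Big(\sum_{r=0}^{L}\binom{L}{r}w_r^2(1-w_r)^{i-1}\Big)\Big(\sum_{r=0}^{L}\binom{L}{r}w_r^2(1-w_r)^{j-1}\Big)$; (2) if $j=k$: $P_k(i,j)=\sum_{r=0}^{L}\binom{L}{r}w_r^3(1-w_r)^{i+k-2}$; (3) if $k+1\le j\le k+i-1$: $P_k(i,j)=\sum_{r_1=0}^{L}\sum_{r_2\ne r_1}\binom{L}{r_1}\binom{L}{r_2}h_3(r_1,r_2)+\sum_{r=0}^{L}\binom{L}{r}\Big\{\binom{L}{r}-1\Big\}h_3(r,r)$, where $h_3(r_1,r_2)=w_{r_1}^2w_{r_2}^2(1-w_{r_1})^{i-j+k-1}(1-w_{r_1}-w_{r_2})^{j-k-1}(1-w_{r_2})^{k-1}$; (4) if $j=k+i$: $P_k(i,j)=0$; (5) if $j\ge k+i+1$: $P_k(i,j)=\sum_{r_1=0}^{L}\sum_{r_2\ne r_1}\binom{L}{r_1}\binom{L}{r_2}h_5(r_1,r_2)+\sum_{r=0}^{L}\binom{L}{r}\Big\{\binom{L}{r}-1\Big\}h_5(r,r)$,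 where $h_5(r_1,r_2)=w_{r_1}^2w_{r_2}^2(1-w_{r_1})^{-i+j-k-1}(1-w_{r_1}-w_{r_2})^{i-1}(1-w_{r_1})^{k-1}$. (In the double sums $r_2$ ranges over $\{0,\dots,L\}\setminus\{r_1\}$.) Moreover, for every integer $K\ge1$, the statistic $f_C=\frac1K\sum_{n=1}^{K}g(A_n)$ satisfies $$\mathrm{Var}[f_C]=\frac1K V+\frac2K\sum_{k=1}^{K-1}\Big(1-\frac kK\Big)C_k,$$ where $$V=\mathrm{Var}[g(A_n)]=\sum_{i=1}^{\infty}g(i)^2\Pr[A_n=i]-\{LH(p)\}^2,$$ $$C_k=\mathrm{Cov}[g(A_n),g(A_{n+k})]=\sum_{i=1}^{\infty}\sum_{j=1}^{\infty}g(i)g(j)P_k(i,j)-\{LH(p)\}^2 .$$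
   Context: Let $(b_n)_{n\in\mathbb{Z}}$ be i.i.d. random blocks with values in $\{0,1\}^L$, where the $L$ bits of each block are independent and each equals $1$ with probability $p$ and $0$ with probability $1-p$ (this is the idealized limit $Q\to\infty$ of infinitely many initialization blocks). For $n\ge1$ let $A_n=\min\{m\in\mathbb{N}: m\ge1,\ b_{n-m}=b_n\}$, which is almost surely finite. Let $g(i)=\frac{1}{\ln 2}\sum_{j=1}^{i-1}\frac1j$ for integers $i\ge1$ (so $g(1)=0$). $H(p)=-p\log_2p-(1-p)\log_2(1-p)$ is the entropy per bit. The convention $0^0=1$ is used. $f_C$ is the test statistic of Coron's universal test applied to $K$ test blocks; with $p=\alpha/2$ it is the statistic of Yamamoto and Liu's test, in which each bit $1$ is independently kept with probability $\alpha$ and otherwise changed to $0$. *)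

(* Defs.v *)
From HB Require Import structures.
From mathcomp Require Import all_boot all_order all_algebra finmap.
From mathcomp Require Import all_classical all_reals all_analysis.

Set Implicit Arguments.
Unset Strict Implicit.
Unset Printing Implicit Defensive.

Import Order.TTheory GRing.Theory Num.Theory.

Local Open Scope classical_set_scope.
Local Open Scope ring_scope.

Section independence.
Context d d' (T : measurableType d) (T' : measurableType d') (R : realType)
  (P : probability T R).

(* The events [X i \in E i] multiply over every finite subfamily; the
   measurability of the [X i] is not part of the definition. *)
Definition mutually_independent (I : choiceType) (X : I -> T -> T') : Prop :=
  forall (J : {fset I}) (E : I -> set T'),
    (forall i, i \in J -> measurable (E i)) ->
    P (\bigcap_(i in [set` J]) (X i @^-1` E i)) =
    (\prod_(i <- J) P (X i @^-1` E i))%E.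

Definition iid (I : choiceType) (X : I -> {mfun T >-> T'}) : Prop :=
  mutually_independent (fun i => X i : T -> T') /\
  forall i j (E : set T'), measurable E ->
    distribution P (X i) E = distribution P (X j) E.

End independence.

(* The bit 1 is [true]. *)
Definition iid_bernoulli_blocks d (T : measurableType d) (R : realType)
    (P : probability T R) (L : nat) (p : R)
    (b : int -> {mfun T >-> L.-tuple bool}) : Prop :=
  [/\ iid P b,
      forall n : int,
        mutually_independent P (fun (l : 'I_L) t => tnth (b n t) l)
    & forall (n : int) (l : 'I_L), P [set t | tnth (b n t) l = true] = p%:E].

Section distance.
Context (T : Type) (L : nat) (b : int -> T -> L.-tuple bool).

Definition recurs (n : int) (t : T) (m : nat) : bool :=
  (0 < m)%N && (b (n - m%:Z) t == b n t).

(* A_n.  When the block [b n t] never occurred before, the minimum is over the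
   empty set and the value is 0, which no genuine distance takes; for i.i.d.
   blocks this is a null event. *)
Definition distance (n : int) (t : T) : nat :=
  if pselect (exists m, recurs n t m) is left h then ex_minn h else 0%N.

End distance.

Section statistics.
Context (R : realType).

Definition g (i : nat) : R := (ln 2)^-1 * \sum_(1 <= j < i) (j%:R)^-1.

Definition log2 (x : R) : R := ln x / ln 2.

Definition bit_entropy (p : R) : R := - p * log2 p - (1 - p) * log2 (1 - p).

Definition g_dist (T : Type) (L : nat) (b : int -> T -> L.-tuple bool)
  (n : nat) (t : T) : R := g (distance b n%:Z t).

Definition coron_stat (T : Type) (L : nat) (b : int -> T -> L.-tuple bool)
  (K : nat) (t : T) : R := K%:R^-1 * \sum_(1 <= n < K.+1) g_dist b n t.

(* Probability of a fixed block with [r] ones. *)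
Definition w (L : nat) (p : R) (r : nat) : R := p ^+ r * (1 - p) ^+ (L - r).

(* In [h3] and [h5] the truncated subtractions in the exponents are exact on
   the ranges of [j] where they are used. *)
Definition h3 (L : nat) (p : R) (k i j r1 r2 : nat) : R :=
  w L p r1 ^+ 2 * w L p r2 ^+ 2 *
  (1 - w L p r1) ^+ (i + k - j - 1) *
  (1 - w L p r1 - w L p r2) ^+ (j - k - 1) *
  (1 - w L p r2) ^+ (k - 1).

Definition h5 (L : nat) (p : R) (k i j r1 r2 : nat) : R :=
  w L p r1 ^+ 2 * w L p r2 ^+ 2 *
  (1 - w L p r1) ^+ (j - i - k - 1) *
  (1 - w L p r1 - w L p r2) ^+ (i - 1) *
  (1 - w L p r1) ^+ (k - 1).

(* Sum over pairs of distinct blocks, grouped by their numbers of ones. *)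
Definition pair_sum (L : nat) (h : nat -> nat -> R) : R :=
  \sum_(r1 < L.+1) \sum_(r2 < L.+1 | r2 != r1)
      'C(L, r1)%:R * 'C(L, r2)%:R * h r1 r2
  + \sum_(r < L.+1) 'C(L, r)%:R * ('C(L, r)%:R - 1) * h r r.

End statistics.

Section laws.
Context d (T : measurableType d) (R : realType) (P : probability T R).
Context (L : nat) (b : int -> T -> L.-tuple bool).

Definition dist_prob (n i : nat) : \bar R :=
  P [set t | distance b n%:Z t = i].

Definition joint_prob (n k i j : nat) : \bar R :=
  P [set t | distance b n%:Z t = i /\ distance b (n + k)%N%:Z t = j].

End laws.

(* Main.v *)
(** Writing [x = b_n] and [y = b_(n+k)], the event [A_n = i, A_(n+k) = j] is the
    disjoint union over [x] and [y] of events that constrain each block of one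
    window separately, so its probability is a sum over [x, y] of products of
    block masses; the five cases of the formula are the possible overlaps of
    the two return windows.  A pair of blocks only enters through its numbers
    of ones.

    Given [b_n = x] of probability [q], [A_n] is geometric, and summation by
    parts together with the logarithmic series gives [E[g(A_n)] = - log2 q];
    averaging over [x] gives the entropy of a block.  Since [g] grows at most
    linearly, [g(A_n)] is square integrable, and the variance formula is the
    usual one for the mean of a stationary sequence. *)
Require Import Defs.
From HB Require Import structures.
From mathcomp Require Import all_boot all_order all_algebra finmap.
From mathcomp Require Import all_classical all_reals all_analysis.
From mathcomp Require Import measurable_realfun zify ring lra.

Set Implicit Arguments.
Unset Strict Implicit.
Unset Printing Implicit Defensive.

Import Order.TTheory GRing.Theory Num.Theory.

Local Open Scope classical_set_scope.
Local Open Scope ring_scope.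

(** * Blocks and their law *)

Section independent_sequences.
Context d d' (T : measurableType d) (T' : measurableType d') (R : realType)
  (P : probability T R).

(** The definition indexes events by finite sets, while enumerations and windows come as
    duplicate-free sequences; the two products agree up to a permutation. *)
Lemma mutually_independent_seq (I : choiceType) (X : I -> T -> T') (s : seq I)
    (E : I -> set T') :
    mutually_independent P X -> uniq s ->
    (forall i, i \in s -> measurable (E i)) ->
  P [set t | forall i, i \in s -> E i (X i t)] =
  (\prod_(i <- s) P (X i @^-1` E i))%E.
Proof.
move=> indX us mE; have ps : perm_eq (seq_fset tt s) s.
  by rewrite -[X in perm_eq _ X](undup_id us); exact: seq_fset_perm.
have mems i : (i \in seq_fset tt s) = (i \in s) by rewrite seq_fsetE.
rewrite -(perm_big _ ps) -indX => [|i]; last by rewrite mems => /mE.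
congr (P _); apply/seteqP; split => t /= H i /=.
  by rewrite mems => /H.
by rewrite -mems => /H.
Qed.

(** Total probability over the values of [X], whose fibres are disjoint and cover [T]. *)
Lemma measure_split_fin (I : finType) (X : T -> I) (A : set T) :
    measurable A -> (forall i, measurable (X @^-1` [set i])) ->
  P A = (\sum_(i : I) P (A `&` X @^-1` [set i]))%E.
Proof.
move=> mA mX; have ps : perm_eq (seq_fset tt (index_enum I)) (index_enum I).
  by rewrite -[X in perm_eq _ X](undup_id (index_enum_uniq I));
    exact: seq_fset_perm.
rewrite -(perm_big _ ps)
  -(@measure_fbigsetU _ _ _ P _ _ (fun i => A `&` X @^-1` [set i]));
    last 2 first.
- by move=> i _; exact: measurableI.
- by move=> i j _ _ [t [[_ /= <-] [_ /= <-]]].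
congr (P _); rewrite -bigcup_seq; apply/seteqP; split => t /=.
  by move=> At; exists (X t) => //=; rewrite (perm_mem ps) mem_index_enum.
by case=> i _ [].
Qed.

End independent_sequences.

(** * Bit tuples sorted by their number of ones *)

Section tuples.
Context (L : nat).
Implicit Types x y z : L.-tuple bool.

Definition ones x := count id x.

Lemma ones_sum x : ones x = (\sum_(l < L) tnth x l)%N.
Proof.
by rewrite /ones -sum1_count [in LHS]big_tuple big_mkcond /=;
  apply: eq_bigr => l _; case: (tnth x l).
Qed.

Lemma ones_card x : ones x = #|[pred l | tnth x l]|.
Proof.
rewrite ones_sum -sum1_card [RHS]big_mkcond; apply: eq_bigr => l _.
by rewrite inE; case: (tnth x l).
Qed.

(** Sending a tuple to the set of positions of its ones is a bijection onto the subsets of ['I_L],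
    under which [ones] becomes the cardinality; ['C(L, r)] subsets have [r] elements. *)
Lemma sum_ones (R : nmodType) (F : nat -> R) :
  \sum_x F (ones x) = \sum_(r < L.+1) F r *+ 'C(L, r).
Proof.
pose f (A : {set 'I_L}) := [tuple l \in A | l < L].
pose f' x := [set l | tnth x l]%SET.
have fK : cancel f f' by move=> A; apply/setP => l; rewrite inE tnth_mktuple.
have f'K : cancel f' f by move=> x; apply: eq_from_tnth => l;
  rewrite tnth_mktuple inE.
have fA A : ones (f A) = #|A|.
  by rewrite ones_sum -sum1_card [RHS]big_mkcond; apply: eq_bigr => l _;
    rewrite tnth_mktuple; case: (l \in A).
rewrite (reindex f) /=; last by exists f' => ? _; [exact: fK | exact: f'K].
have cA (A : {set 'I_L}) : (#|A| < L.+1)%N.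
  by rewrite ltnS -[X in (_ <= X)%N](card_ord L) max_card.
rewrite (partition_big (fun A => Ordinal (cA A)) xpredT) //=.
apply: eq_bigr => r _.
rewrite (eq_bigr (fun=> F r)) => [|A /eqP <-]; last by rewrite fA.
rewrite sumr_const; congr (_ *+ _).
rewrite -[X in 'C(X, _)](card_ord L) -card_draws; apply: eq_card => A.
by rewrite !inE.
Qed.

(** A singleton is a finite intersection of coordinate preimages, and any set of tuples is a finite
    union of singletons. *)
Lemma measurable_blocks (A : set (L.-tuple bool)) : measurable A.
Proof.
rewrite (_ : A = \bigcup_(x in A) [set x]); last first.
  by apply/seteqP; split => [x Ax|x [y Ay ->//]]; exists x.
apply: fin_bigcup_measurable; first exact: finite_finset.
move=> x _; rewrite (_ : [set x] = \bigcap_(l in [set: 'I_L])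
    (fun z => tnth z l) @^-1` [set tnth x l]).
  apply: fin_bigcap_measurable => // l _.
  by rewrite -[X in measurable X]setTI; exact: measurable_tnth.
apply/seteqP; split => [z -> //|z H].
by apply: eq_from_tnth => l; exact: (H l).
Qed.

End tuples.

(** * The law of one block and of a window of consecutive blocks *)

Section block_law.
Context (R : realType) (d : measure_display) (T : measurableType d)
  (P : probability T R) (L : nat) (p : R)
  (b : int -> {mfun T >-> L.-tuple bool}).
Context (hb : iid_bernoulli_blocks P p b).
Implicit Types (x y z : L.-tuple bool) (A B : pred (L.-tuple bool)).

Definition block_mass A : R := \sum_(x | A x) w L p (ones x).

Lemma measurable_block_preimage n (A : set (L.-tuple bool)) :
  measurable (b n @^-1` A).
Proof.
by rewrite -[X in measurable X]setTI; apply: measurable_funPT => //;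
  exact: measurable_blocks.
Qed.

(** Independence of the bits gives a factor [p] for each one and [1 - p] for each zero. *)
Lemma prob_block n x : P (b n @^-1` [set x]) = (w L p (ones x))%:E.
Proof.
have [_ /(_ n) hI hp] := hb.
have := @mutually_independent_seq _ _ _ _ _ _ _ _ (enum 'I_L)
  (fun l => [set tnth x l]) hI (enum_uniq _) (fun _ _ => I).
rewrite (_ : [set t | _] = b n @^-1` [set x]); last first.
  apply/seteqP; split => t /= H; last by move=> l _; rewrite H.
  by apply: eq_from_tnth => l; apply: H; rewrite mem_enum.
move=> ->; rewrite big_enum /=.
have -> : w L p (ones x) = \prod_(l < L) (if tnth x l then p else 1 - p).
  rewrite (bigID (fun l => tnth x l)) /= [X in X * _](eq_bigr (fun=> p)) =>
    [|l ->//].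
  rewrite [X in _ * X](eq_bigr (fun=> 1 - p)) => [|l /negbTE ->//].
  rewrite !prodr_const ones_card /w; congr (_ ^+ _ * _ ^+ _).
  rewrite -[X in (X - _)%N](card_ord L) -(cardC [pred l | tnth x l]).
  by rewrite addKn; apply: eq_card.
rewrite -prodEFin; apply: eq_bigr => l _.
case: (boolP (tnth x l)) => xl.
  by rewrite -(hp n l); congr (P _); apply/seteqP; split => t /=; rewrite xl.
rewrite (_ : _ @^-1` _ = ~` [set t | tnth (b n t) l = true]); last first.
  by apply/seteqP; split => t /=; move: xl; case: (tnth x l) => // _;
    case: (tnth (b n t) l).
rewrite probability_setC ?hp//.
exact: (@measurable_block_preimage n [set z | tnth z l = true]).
Qed.

Lemma prob_block_in n A : P [set t | A (b n t)] = (block_mass A)%:E.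
Proof.
have mA : measurable [set t | A (b n t)].
  exact: (@measurable_block_preimage n [set z | A z]).
rewrite (@measure_split_fin _ _ _ P _ (b n) _ mA) => [|x];
  last exact: measurable_block_preimage.
rewrite /block_mass -sumEFin [RHS]big_mkcond /=; apply: eq_bigr => x _.
case: ifPn => Ax.
  rewrite -(prob_block n); congr (P _); apply/seteqP; split => t /=;
    first by case.
  by move=> tx; rewrite tx.
rewrite (_ : _ `&` _ = set0) ?measure0 //; apply/seteqP; split => t //= [+ tx].
by rewrite tx (negbTE Ax).
Qed.

(** Read off from the total mass of [P] rather than from the binomial theorem. *)
Lemma block_massT : block_mass predT = 1.
Proof.
apply/EFin_inj; rewrite -(prob_block_in 0) -[RHS](@probability_setT _ _ _ P).
by congr (P _); apply/seteqP; split.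
Qed.

Lemma block_massC A : block_mass (predC A) = 1 - block_mass A.
Proof.
by rewrite -block_massT /block_mass [in RHS](bigID A) /= addrAC subrr add0r.
Qed.

Lemma eq_block_mass A B : A =1 B -> block_mass A = block_mass B.
Proof. by move=> AB; apply: eq_bigl. Qed.

Lemma block_mass1 x : block_mass (pred1 x) = w L p (ones x).
Proof. by rewrite /block_mass big_pred1_eq. Qed.

Lemma block_mass0 : block_mass pred0 = 0.
Proof. exact: big_pred0. Qed.

Lemma block_massC1 x : block_mass (predC1 x) = 1 - w L p (ones x).
Proof. by rewrite -block_mass1 -block_massC. Qed.

Lemma block_massC2 x y : x != y ->
  block_mass (predC (pred2 x y)) = 1 - w L p (ones x) - w L p (ones y).
Proof.
move=> xy; rewrite block_massC /block_mass (bigD1 x) /= ?eqxx//.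
rewrite (bigD1 y) /= ?eqxx ?orbT//= 1?eq_sym//.
rewrite big_pred0 => [|z]; last by case: (z == x); case: (z == y).
ring.
Qed.

(** Distinct lags name distinct blocks, so independence of the family [b] yields one factor per
    lag. *)
Lemma prob_window (n : int) N (A : nat -> pred (L.-tuple bool)) :
  P [set t | forall l, (l < N)%N -> A l (b (n - l%:Z) t)] =
  (\prod_(0 <= l < N) block_mass (A l))%:E.
Proof.
have [[hI _] _ _] := hb.
pose s := [seq n - l%:Z | l <- index_iota 0 N].
have us : uniq s by rewrite map_inj_uniq ?iota_uniq//
  => i j /= /addrI /oppr_inj [].
(* Independence is indexed by the position [i] of a block; its lag is recovered as
   [absz (n - i)]. *)
have := @mutually_independent_seq _ _ _ _ _ _ _ _ s
  (fun i => [set z | A (absz (n - i)%R) z]) hI us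
  (fun _ _ => measurable_blocks _).
have nl (l : nat) : absz (n - (n - l%:Z))%R = l by lia.
rewrite (_ : [set t | _] =
  [set t | forall l, (l < N)%N -> A l (b (n - l%:Z) t)]); last first.
  apply/seteqP; split => t /= H.
    move=> l lN; have := H (n - l%:Z); rewrite nl; apply.
    by apply: map_f; rewrite mem_index_iota.
  move=> i /mapP [l]; rewrite mem_index_iota /= => lN ->.
  by rewrite nl; exact: H.
move=> ->; rewrite big_map -prodEFin; apply: eq_bigr => l _.
by rewrite nl; exact: prob_block_in.
Qed.

End block_law.

(** * Joint law of two distances *)

Section first_return.
Context (T : Type) (L : nat) (b : int -> T -> L.-tuple bool).

(* What [b_(n-l)] may be, for [l <= i], when [b_n = x] and [A_n = i]. *)
Definition first_return (i : nat) (x : L.-tuple bool) (l : nat) :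
    pred (L.-tuple bool) :=
  fun z => (z == x) == ((l == 0) || (l == i))%N.

(** Minimality of the return lag means equality with [b_n] at lags [0] and [i] and inequality
    strictly between. This trades a statement about a minimum for one constraint per block. *)
Lemma distance_eqP n t i : (0 < i)%N ->
  distance b n t = i <->
  forall l, (l <= i)%N -> first_return i (b n t) l (b (n - l%:Z) t).
Proof.
move=> i0; rewrite /distance /first_return; split.
  (* Without any recurrence the distance is the default [0], which [0 < i] excludes. *)
  case: pselect => [h|_ i_eq]; last by rewrite -i_eq in i0.
  case: ex_minnP => m /andP[_ rm] min_m <- l lm.
  have [->|l0] := posnP l; first by rewrite subr0 !eqxx.
  have [->|lm'] /= := eqVneq l m; first by rewrite rm.
  rewrite eqbF_neg; apply/negP => le; have := min_m l.
  by rewrite /recurs l0 le leqNgt ltn_neqAle lm' lm => /(_ isT).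
move=> H; have ri : recurs b n t i.
  by rewrite /recurs i0; have := H i (leqnn _); rewrite eqxx orbT => /eqP.
case: pselect => [h|[]]; last by exists i.
case: ex_minnP => m /andP[m0 rm] /(_ _ ri) mi.
apply/eqP; apply: contraT => mi'.
by have := H m mi; rewrite rm (negbTE mi') eqn0Ngt m0.
Qed.

End first_return.

(** * Probabilities of distances as sums of products of block masses *)

Section distance_law.
Context (R : realType) (d : measure_display) (T : measurableType d)
  (P : probability T R) (L : nat) (p : R)
  (b : int -> {mfun T >-> L.-tuple bool}).
Context (hb : iid_bernoulli_blocks P p b).
Implicit Types (x y z : L.-tuple bool) (A B : pred (L.-tuple bool)).

Lemma measurable_recurs n m : measurable [set t | recurs b n t m].
Proof.
rewrite /recurs; case: (posnP m) => [->|m0].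
  by rewrite (_ : [set _ | _] = set0)//; apply/seteqP; split.
rewrite (_ : [set _ | _] = \bigcup_(x in [set: L.-tuple bool])
    (b (n - m%:Z) @^-1` [set x] `&` b n @^-1` [set x])).
  apply: fin_bigcup_measurable => [|x _]; first exact: finite_finset.
  by apply: measurableI; exact: measurable_block_preimage.
apply/seteqP; split => t /=; first by move=> /eqP e; exists (b n t).
by case=> x _ [-> ->].
Qed.

Lemma measurable_distance_eq n i : measurable [set t | distance b n t = i].
Proof.
have mN m : measurable (~` [set t | recurs b n t m]).
  by apply: measurableC; exact: measurable_recurs.
(* The value [0] is taken exactly when no lag recurs, which is a countable intersection; a positive
   value involves finitely many lags. *)
case: i => [|i].
  rewrite (_ : [set _ | _] = \bigcap_m ~` [set t | recurs b n t m]).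
    exact: bigcap_measurableType.
  apply/seteqP; split => t /=; rewrite /distance; case: pselect => //.
  - by move=> h; case: ex_minnP => m + _ m0; rewrite m0 /recurs.
  - by move=> h _ m _ rm; apply: h; exists m.
  - by move=> [m rm] /(_ m I).
rewrite (_ : [set _ | _] = [set t | recurs b n t i.+1] `&`
    \bigcap_(m in `I_i.+1) ~` [set t | recurs b n t m]).
  apply: measurableI; first exact: measurable_recurs.
  by apply: bigcap_measurableType => m _; exact: mN.
apply/seteqP; split => t /=; rewrite /distance; case: pselect => //.
- move=> h; case: ex_minnP => m rm min_m mi; split; first by rewrite -mi.
  by move=> k /= ki rk; have := min_m _ rk; rewrite mi leqNgt ki.
- move=> h [ri H]; case: ex_minnP => m rm /(_ _ ri) mi.
  apply/eqP; apply: contraT => mi'.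
  by exfalso; apply: (H m) => //=; rewrite ltn_neqAle mi' mi.
- by move=> h [ri _]; case: h; exists i.+1.
Qed.

(* Here [l] counts backwards from [n + k]. *)
Definition joint_return (k i j : nat) (x y : L.-tuple bool) (l : nat) :
    pred (L.-tuple bool) :=
  fun z => ((l <= j)%N ==> first_return j y l z) &&
           ((k <= l <= k + i)%N ==> first_return i x (l - k) z).

Definition joint_mass k i j x y l := block_mass p (joint_return k i j x y l).

(** Once [b_n = x] is fixed, the constraints bear on separate blocks and [prob_window] applies. *)
Lemma dist_prob_mass n i : (0 < i)%N ->
  dist_prob P b n i =
  (\sum_(x : L.-tuple bool)
     \prod_(0 <= l < i.+1) block_mass p (first_return i x l))%:E.
Proof.
move=> i0; rewrite /dist_prob (@measure_split_fin _ _ _ P _ (b n));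
  last 2 first.
- exact: measurable_distance_eq.
- by move=> x; exact: measurable_block_preimage.
rewrite -sumEFin; apply: eq_bigr => x _.
rewrite -(prob_window hb n); congr (P _).
apply/seteqP; split => t /=.
  by move=> [/(distance_eqP _ _ _ i0) H tx] l li; rewrite -tx; apply: H.
move=> H; have tx : b n t = x.
  by have := H 0%N isT; rewrite /first_return subr0 => /eqP/eqP.
by split => //; apply/distance_eqP => // l li; rewrite tx; apply: H.
Qed.

(** The lags [0] to [maxn (k + i) j] back from [n + k] reach every block that either distance
    constrains. The right-hand side is free of [n], which is where stationarity comes from. *)
Lemma joint_prob_mass n k i j : (0 < i)%N -> (0 < j)%N ->
  joint_prob P b n k i j =
  (\sum_(x : L.-tuple bool) \sum_(y : L.-tuple bool)
     \prod_(0 <= l < (maxn (k + i) j).+1) joint_mass k i j x y l)%:E.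
Proof.
move=> i0 j0; rewrite /joint_prob (@measure_split_fin _ _ _ P _ (b n));
  last 2 first.
- by apply: measurableI; exact: measurable_distance_eq.
- by move=> x; exact: measurable_block_preimage.
rewrite -sumEFin; apply: eq_bigr => x _.
rewrite (@measure_split_fin _ _ _ P _ (b (n + k)%N)); last 2 first.
- apply: measurableI; last exact: measurable_block_preimage.
  by apply: measurableI; exact: measurable_distance_eq.
- by move=> y; exact: measurable_block_preimage.
rewrite -sumEFin; apply: eq_bigr => y _.
rewrite -(prob_window hb (n + k)%N); congr (P _).
(* A lag [l >= k] seen from [n + k] is the lag [l - k] seen from [n]. *)
have shift (l : nat) : (k <= l)%N ->
  (n + k)%:Z - l%:Z = n%:Z - (l - k)%N%:Z by lia.
apply/seteqP; split => t /=.
  move=> [[[/(distance_eqP _ _ _ i0) Hi /(distance_eqP _ _ _ j0) Hj] tx] ty].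
  move=> l _.
  rewrite /joint_return; apply/andP; split; apply/implyP.
    by rewrite -ty; exact: Hj.
  by move=> /andP[kl li]; rewrite -tx shift//; apply: Hi; rewrite leq_subLR.
move=> H; have ty : b (n + k)%N t = y.
  have /andP[+ _] := H 0%N isT.
  by rewrite /first_return subr0 /= => /eqP/eqP.
have tx : b n t = x.
  have /andP[_] : joint_return k i j x y k (b ((n + k)%N%:Z - k%:Z) t).
    by apply: H; rewrite ltnS leq_max leq_addr.
  by rewrite shift// /first_return leqnn leq_addr subnn subr0 /= => /eqP/eqP.
split=> //; split=> //; split; apply/distance_eqP => // l.
  move=> li.
  have : joint_return k i j x y (k + l) (b ((n + k)%N%:Z - (k + l)%N%:Z) t).
    by apply: H; rewrite ltnS leq_max leq_add2l li.
  move=> /andP[_]; rewrite leq_addr leq_add2l li /= tx shift ?leq_addr//.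
  by rewrite addKn.
move=> lj.
have /andP[+ _] : joint_return k i j x y l (b ((n + k)%N%:Z - l%:Z) t).
  by apply: H; rewrite ltnS leq_max lj orbT.
by rewrite lj ty.
Qed.

End distance_law.

(** Window products are evaluated by repeatedly cutting off a run of lags that share one factor. *)
Lemma prod_cut (R : pzRingType) (f : nat -> R) (v : R) (a c e : nat) :
    (a <= c <= e)%N -> (forall l, (a <= l < c)%N -> f l = v) ->
  \prod_(a <= l < e) f l = v ^+ (c - a) * \prod_(c <= l < e) f l.
Proof.
move=> /andP[ac ce] fv; rewrite (@big_cat_nat _ _ _ c a e _ _ ac ce) /=;
  congr (_ * _).
by rewrite (eq_big_nat _ _ fv) prodr_const_nat.
Qed.

Lemma prod_eq0 (R : pzSemiRingType) (f : nat -> R) (a c e : nat) :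
  (a <= c < e)%N -> f c = 0 -> \prod_(a <= l < e) f l = 0.
Proof.
move=> /andP[ac ce] f0; rewrite (@big_cat_nat _ _ _ c a e _ _ ac (ltnW ce)) /=.
by rewrite [X in _ * X]big_ltn// f0 mul0r mulr0.
Qed.

(** * Evaluation of the window products, one relative position of the two returns at a time *)

Section joint_masses.
Context (R : realType) (d : measure_display) (T : measurableType d)
  (P : probability T R) (L : nat) (p : R)
  (b : int -> {mfun T >-> L.-tuple bool}).
Context (hb : iid_bernoulli_blocks P p b).
Implicit Types (x y z : L.-tuple bool) (A B : pred (L.-tuple bool)).

Local Notation q x := (w L p (ones x)).

Lemma joint_massE A k i j x y l : joint_return k i j x y l =1 A ->
  joint_mass p k i j x y l = block_mass p A.
Proof. exact: eq_block_mass. Qed.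

(** Decides every comparison of the lag [l] with the ends of the two return windows, discarding
    impossible positions by [lia]; a Boolean identity in [z] remains. *)
Ltac locate l k i j :=
  rewrite /joint_return /first_return /=;
  case: (leqP l j) => ?; try (exfalso; lia);
  case: (leqP k l) => ?; try (exfalso; lia);
  case: (leqP l (k + i)) => ?; try (exfalso; lia);
  case: (eqVneq l 0%N) => ?; try (exfalso; lia);
  case: (eqVneq l j) => ?; try (exfalso; lia);
  case: (eqVneq (l - k)%N 0%N) => ?; try (exfalso; lia);
  case: (eqVneq (l - k)%N i) => ?; try (exfalso; lia).

(** Lags [0] and [i] carry [x], and the [i - 1] lags between them avoid it. *)
Lemma first_return_prod i x : (0 < i)%N ->
  \prod_(0 <= l < i.+1) block_mass p (first_return i x l) =
  q x ^+ 2 * (1 - q x) ^+ (i - 1).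
Proof.
move=> i0.
have E A l : first_return i x l =1 A ->
  block_mass p (first_return i x l) = block_mass p A by exact: eq_block_mass.
rewrite (@prod_cut _ _ (q x) 0 1) => [| |l li]; [|lia|]; last first.
  rewrite -block_mass1; apply: E => z; rewrite /first_return /=.
  by rewrite (_ : l = 0)%N; [case: (z == x) | lia].
rewrite (@prod_cut _ _ (1 - q x) 1 i) => [| |l li]; [|lia|]; last first.
  rewrite -(block_massC1 hb); apply: E => z; rewrite /first_return /=.
  by rewrite (_ : (l == 0)%N || (l == i) = false); [case: (z == x) | lia].
rewrite (@prod_cut _ _ (q x) i i.+1) => [| |l li]; [|lia|]; last first.
  rewrite -block_mass1; apply: E => z; rewrite /first_return /=.
  by rewrite (_ : l = i)%N; [rewrite eqxx ?orbT; case: (z == x) | lia].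
rewrite big_geq// !subSnn; ring.
Qed.

(** The return to [y] ends at lag [j], before the one to [x] starts at lag [k]; the lags strictly
    between are free and have mass [1]. *)
Lemma joint_prod_before k i j x y : (0 < i)%N -> (0 < j < k)%N ->
  \prod_(0 <= l < (maxn (k + i) j).+1) joint_mass p k i j x y l =
  (q x ^+ 2 * (1 - q x) ^+ (i - 1)) * (q y ^+ 2 * (1 - q y) ^+ (j - 1)).
Proof.
move=> i0 jk; rewrite (_ : maxn (k + i) j = k + i)%N; last lia.
rewrite (@prod_cut _ _ (q y) 0 1) => [| |l li]; [|lia|]; last first.
  by rewrite -block_mass1; apply: joint_massE => z; locate l k i j;
    case: (z == y).
rewrite (@prod_cut _ _ (1 - q y) 1 j) => [| |l li]; [|lia|]; last first.
  by rewrite -(block_massC1 hb); apply: joint_massE => z; locate l k i j;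
    case: (z == y).
rewrite (@prod_cut _ _ (q y) j j.+1) => [| |l li]; [|lia|]; last first.
  by rewrite -block_mass1; apply: joint_massE => z; locate l k i j;
    case: (z == y).
rewrite (@prod_cut _ _ 1 j.+1 k) => [| |l li]; [|lia|]; last first.
  by rewrite -(block_massT hb); apply: joint_massE => z; locate l k i j.
rewrite (@prod_cut _ _ (q x) k k.+1) => [| |l li]; [|lia|]; last first.
  by rewrite -block_mass1; apply: joint_massE => z; locate l k i j;
    case: (z == x).
rewrite (@prod_cut _ _ (1 - q x) k.+1 (k + i)) => [| |l li]; [|lia|];
  last first.
  by rewrite -(block_massC1 hb); apply: joint_massE => z; locate l k i j;
    case: (z == x).
rewrite (@prod_cut _ _ (q x) (k + i)%N (k + i).+1) => [| |l li]; [|lia|];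
  last first.
  by rewrite -block_mass1; apply: joint_massE => z; locate l k i j;
    case: (z == x).
rewrite big_geq// !subSnn expr1n (_ : k + i - k.+1 = i - 1)%N; last lia.
ring.
Qed.

(** The block at lag [k] both closes the later return and opens the earlier one, so [x] occurs three
    times and is avoided [(k - 1) + (i - 1)] times. *)
Lemma joint_prod_at k i x : (0 < i)%N -> (0 < k)%N ->
  \prod_(0 <= l < (maxn (k + i) k).+1) joint_mass p k i k x x l =
  q x ^+ 3 * (1 - q x) ^+ (i + k - 2).
Proof.
move=> i0 k0; rewrite (_ : maxn (k + i) k = k + i)%N; last lia.
rewrite (@prod_cut _ _ (q x) 0 1) => [| |l li]; [|lia|]; last first.
  by rewrite -block_mass1; apply: joint_massE => z; locate l k i k;
    case: (z == x).
rewrite (@prod_cut _ _ (1 - q x) 1 k) => [| |l li]; [|lia|]; last first.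
  by rewrite -(block_massC1 hb); apply: joint_massE => z; locate l k i k;
    case: (z == x).
rewrite (@prod_cut _ _ (q x) k k.+1) => [| |l li]; [|lia|]; last first.
  by rewrite -block_mass1; apply: joint_massE => z; locate l k i k;
    case: (z == x).
rewrite (@prod_cut _ _ (1 - q x) k.+1 (k + i)) => [| |l li]; [|lia|];
  last first.
  by rewrite -(block_massC1 hb); apply: joint_massE => z; locate l k i k;
    case: (z == x).
rewrite (@prod_cut _ _ (q x) (k + i)%N (k + i).+1) => [| |l li]; [|lia|];
  last first.
  by rewrite -block_mass1; apply: joint_massE => z; locate l k i k;
    case: (z == x).
rewrite big_geq// !subSnn (_ : i + k - 2 = (k - 1) + (k + i - k.+1))%N;
  last lia.
rewrite exprD; ring.
Qed.

(** The block at lag [k] would have to equal both [x] and [y]. *)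
Lemma joint_prod_at_neq k i x y : (0 < i)%N -> (0 < k)%N -> x != y ->
  \prod_(0 <= l < (maxn (k + i) k).+1) joint_mass p k i k x y l = 0.
Proof.
move=> i0 k0 xy; apply: (@prod_eq0 _ _ _ k); first lia.
rewrite -(@block_mass0 R L p); apply: joint_massE => z; locate k k i k.
by case: (eqVneq z x) => [->|]; [rewrite (negbTE xy) | rewrite andbF].
Qed.

(** Lag [k] lies strictly inside the later return, so its block must avoid [x], yet it is
    [b_n = x]. *)
Lemma joint_prod_diag k i j x : (0 < i)%N -> (0 < k < j)%N ->
  \prod_(0 <= l < (maxn (k + i) j).+1) joint_mass p k i j x x l = 0.
Proof.
move=> i0 kj; apply: (@prod_eq0 _ _ _ k); first lia.
rewrite -(@block_mass0 R L p); apply: joint_massE => z; locate k k i j.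
by case: (z == x).
Qed.

(** Both returns would close at the same block, at lag [k + i]. *)
Lemma joint_prod_same_start k i x y : (0 < i)%N -> (0 < k)%N -> x != y ->
  \prod_(0 <= l < (maxn (k + i) (k + i)).+1) joint_mass p k i (k + i) x y l = 0.
Proof.
move=> i0 k0 xy; apply: (@prod_eq0 _ _ _ (k + i)); first lia.
rewrite -(@block_mass0 R L p); apply: joint_massE => z.
locate (k + i)%N k i (k + i)%N.
by case: (eqVneq z x) => [->|]; [rewrite (negbTE xy) | rewrite andbF].
Qed.

(** Back from [n + k] the lags read: [y], not [y], [x] at [k], neither, [y] at [j], not [x], [x] at
    [k + i]. The stretch avoiding both blocks gives the factor [1 - q x - q y]. *)
Lemma joint_prod_inside k i j x y : (0 < i)%N -> (0 < k < j)%N ->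
    (j < k + i)%N -> x != y ->
  \prod_(0 <= l < (maxn (k + i) j).+1) joint_mass p k i j x y l =
  h3 L p k i j (ones x) (ones y).
Proof.
move=> i0 kj ji xy; rewrite (_ : maxn (k + i) j = k + i)%N; last lia.
rewrite (@prod_cut _ _ (q y) 0 1) => [| |l li]; [|lia|]; last first.
  by rewrite -block_mass1; apply: joint_massE => z; locate l k i j;
    case: (z == y).
rewrite (@prod_cut _ _ (1 - q y) 1 k) => [| |l li]; [|lia|]; last first.
  by rewrite -(block_massC1 hb); apply: joint_massE => z; locate l k i j;
    case: (z == y).
rewrite (@prod_cut _ _ (q x) k k.+1) => [| |l li]; [|lia|]; last first.
  rewrite -block_mass1; apply: joint_massE => z; locate l k i j.
  by case: (eqVneq z x) => [->|]; [rewrite (negbTE xy) | case: (z == y)].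
rewrite (@prod_cut _ _ (1 - q x - q y) k.+1 j) => [| |l li]; [|lia|];
  last first.
  rewrite -(block_massC2 hb xy); apply: joint_massE => z; locate l k i j.
  by case: (z == x); case: (z == y).
rewrite (@prod_cut _ _ (q y) j j.+1) => [| |l li]; [|lia|]; last first.
  rewrite -block_mass1; apply: joint_massE => z; locate l k i j.
  by case: (eqVneq z x) => [->|]; [rewrite (negbTE xy) | case: (z == y)].
rewrite (@prod_cut _ _ (1 - q x) j.+1 (k + i)) => [| |l li]; [|lia|];
  last first.
  by rewrite -(block_massC1 hb); apply: joint_massE => z; locate l k i j;
    case: (z == x).
rewrite (@prod_cut _ _ (q x) (k + i)%N (k + i).+1) => [| |l li]; [|lia|];
  last first.
  by rewrite -block_mass1; apply: joint_massE => z; locate l k i j;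
    case: (z == x).
rewrite big_geq// !subSnn /h3.
rewrite (_ : i + k - j - 1 = k + i - j.+1)%N; last lia.
rewrite (_ : j - k - 1 = j - k.+1)%N; last lia.
ring.
Qed.

(* The first index of [h5] belongs to the later block [y], that of [h3] to the
   earlier block [x]. *)
Lemma joint_prod_beyond k i j x y : (0 < i)%N -> (0 < k)%N ->
    (k + i < j)%N -> x != y ->
  \prod_(0 <= l < (maxn (k + i) j).+1) joint_mass p k i j x y l =
  h5 L p k i j (ones y) (ones x).
Proof.
move=> i0 k0 ji xy; rewrite (_ : maxn (k + i) j = j)%N; last lia.
rewrite (@prod_cut _ _ (q y) 0 1) => [| |l li]; [|lia|]; last first.
  by rewrite -block_mass1; apply: joint_massE => z; locate l k i j;
    case: (z == y).
rewrite (@prod_cut _ _ (1 - q y) 1 k) => [| |l li]; [|lia|]; last first.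
  by rewrite -(block_massC1 hb); apply: joint_massE => z; locate l k i j;
    case: (z == y).
rewrite (@prod_cut _ _ (q x) k k.+1) => [| |l li]; [|lia|]; last first.
  rewrite -block_mass1; apply: joint_massE => z; locate l k i j.
  by case: (eqVneq z x) => [->|]; [rewrite (negbTE xy) | case: (z == y)].
rewrite (@prod_cut _ _ (1 - q x - q y) k.+1 (k + i)) => [| |l li]; [|lia|];
  last first.
  rewrite -(block_massC2 hb xy); apply: joint_massE => z; locate l k i j.
  by case: (z == x); case: (z == y).
rewrite (@prod_cut _ _ (q x) (k + i)%N (k + i).+1) => [| |l li]; [|lia|];
  last first.
  rewrite -block_mass1; apply: joint_massE => z; locate l k i j.
  by case: (eqVneq z x) => [->|]; [rewrite (negbTE xy) | case: (z == y)].
rewrite (@prod_cut _ _ (1 - q y) (k + i).+1 j) => [| |l li]; [|lia|];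
  last first.
  by rewrite -(block_massC1 hb); apply: joint_massE => z; locate l k i j;
    case: (z == y).
rewrite (@prod_cut _ _ (q y) j j.+1) => [| |l li]; [|lia|]; last first.
  by rewrite -block_mass1; apply: joint_massE => z; locate l k i j;
    case: (z == y).
rewrite big_geq// !subSnn /h5.
rewrite (_ : j - i - k - 1 = j - (k + i).+1)%N; last lia.
rewrite (_ : k + i - k.+1 = i - 1)%N; last lia.
rewrite (_ : 1 - q y - q x = 1 - q x - q y); last ring.
ring.
Qed.

End joint_masses.

(** * From sums over blocks to sums over numbers of ones *)

Lemma sum_ones_ring (R : pzRingType) (L : nat) (F : nat -> R) :
  \sum_(x : L.-tuple bool) F (ones x) = \sum_(r < L.+1) 'C(L, r)%:R * F r.
Proof. by rewrite sum_ones; apply: eq_bigr => r _; rewrite mulr_natl. Qed.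

(** Pairs of distinct blocks are all pairs minus the diagonal. For equal numbers of ones [r] this
    leaves ['C(L, r) ^ 2 - 'C(L, r)] pairs, hence the second sum of [pair_sum]. *)
Lemma pair_sumE (R : realType) (L : nat) (h : nat -> nat -> R) :
  \sum_(x : L.-tuple bool) \sum_(y : L.-tuple bool | y != x)
    h (ones x) (ones y) = pair_sum L h.
Proof.
transitivity (\sum_(x : L.-tuple bool) \sum_(y : L.-tuple bool) h (ones x)
  (ones y)
   - \sum_(x : L.-tuple bool) h (ones x) (ones x)).
  rewrite -sumrB; apply: eq_bigr => x _.
  by rewrite [in RHS](bigD1 x)//= addrAC subrr add0r.
rewrite (eq_bigr (fun x : L.-tuple bool => \sum_(r2 < L.+1) 'C(L, r2)%:R * h
  (ones x) r2)); last first.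
  by move=> x _; rewrite (sum_ones_ring L (h (ones x))).
rewrite (sum_ones_ring L (fun r => \sum_(r2 < L.+1) 'C(L, r2)%:R * h r r2)).
rewrite (sum_ones_ring L (fun r => h r r)) /pair_sum -sumrB -big_split /=.
apply: eq_bigr => r _; rewrite mulr_sumr [in LHS](bigD1 r)//=.
rewrite (eq_bigr (fun i : 'I_L.+1 => 'C(L, r)%:R * 'C(L, i)%:R * h r i)) =>
  [|i _]; last by rewrite mulrA.
ring.
Qed.

Section distance_formulas.
Context (R : realType) (d : measure_display) (T : measurableType d)
  (P : probability T R) (L : nat) (p : R)
  (b : int -> {mfun T >-> L.-tuple bool}).
Context (hb : iid_bernoulli_blocks P p b).

Lemma dist_probE n i : (0 < i)%N ->
  dist_prob P b n i =
  (\sum_(r < L.+1) 'C(L, r)%:R * w L p r ^+ 2 * (1 - w L p r) ^+ (i - 1))%:E.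
Proof.
move=> i0; rewrite (dist_prob_mass hb)//; congr EFin.
rewrite (eq_bigr _ (fun x _ => first_return_prod hb x i0)).
rewrite (sum_ones_ring L (fun r => w L p r ^+ 2 * (1 - w L p r) ^+ (i - 1))).
by apply: eq_bigr => r _; rewrite mulrA.
Qed.

Lemma joint_prob_stationary n n' k i j : (0 < i)%N -> (0 < j)%N ->
  joint_prob P b n k i j = joint_prob P b n' k i j.
Proof. by move=> i0 j0; rewrite !(joint_prob_mass hb). Qed.

Lemma joint_prob_before n k i j : (0 < i)%N -> (0 < j < k)%N ->
  joint_prob P b n k i j =
    ((\sum_(r < L.+1) 'C(L, r)%:R * w L p r ^+ 2 * (1 - w L p r) ^+ (i - 1)) *
     (\sum_(r < L.+1) 'C(L, r)%:R * w L p r ^+ 2 * (1 - w L p r) ^+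
       (j - 1)))%:E.
Proof.
move=> i0 jk; have /andP[j0 _] := jk.
rewrite (joint_prob_mass hb)//; congr EFin.
rewrite (eq_bigr _ (fun x _ => eq_bigr _ (fun y _
  => joint_prod_before hb x y i0 jk))).
rewrite -big_distrlr /=.
rewrite (sum_ones_ring L (fun r => w L p r ^+ 2 * (1 - w L p r) ^+ (i - 1))).
rewrite (sum_ones_ring L (fun r => w L p r ^+ 2 * (1 - w L p r) ^+ (j - 1))).
by congr (_ * _); apply: eq_bigr => r _; rewrite mulrA.
Qed.

Lemma joint_prob_at n k i : (0 < i)%N -> (0 < k)%N ->
  joint_prob P b n k i k =
    (\sum_(r < L.+1) 'C(L, r)%:R * w L p r ^+ 3 * (1 - w L p r) ^+
      (i + k - 2))%:E.
Proof.
move=> i0 k0; rewrite (joint_prob_mass hb)//; congr EFin.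
under eq_bigr => x _.
  rewrite (bigD1 x)//= (joint_prod_at hb)// big1 ?addr0.
    over.
  by move=> y yx; apply: joint_prod_at_neq; rewrite // eq_sym.
rewrite (sum_ones_ring L (fun r => w L p r ^+ 3 * (1 - w L p r) ^+
  (i + k - 2))).
by apply: eq_bigr => r _; rewrite mulrA.
Qed.

Lemma joint_prob_inside n k i j : (0 < i)%N -> (0 < k < j)%N -> (j < k + i)%N ->
  joint_prob P b n k i j = (pair_sum L (h3 L p k i j))%:E.
Proof.
move=> i0 kj ji; have j0 : (0 < j)%N by lia.
rewrite (joint_prob_mass hb)//; congr EFin; rewrite -pair_sumE.
apply: eq_bigr => x _; rewrite (bigD1 x)//= joint_prod_diag// add0r.
by apply: eq_bigr => y yx; apply: (joint_prod_inside hb); rewrite // eq_sym.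
Qed.

Lemma joint_prob_same_start n k i : (0 < i)%N -> (0 < k)%N ->
  joint_prob P b n k i (k + i) = 0%E.
Proof.
move=> i0 k0; rewrite (joint_prob_mass hb) ?addn_gt0 ?i0 ?orbT//.
rewrite big1 // => x _; rewrite big1// => y _.
have [->|xy] := eqVneq x y; last exact: joint_prod_same_start.
by apply: joint_prod_diag; lia.
Qed.

Lemma joint_prob_beyond n k i j : (0 < i)%N -> (0 < k)%N -> (k + i < j)%N ->
  joint_prob P b n k i j = (pair_sum L (h5 L p k i j))%:E.
Proof.
move=> i0 k0 ji; have j0 : (0 < j)%N by lia.
(* The sums are exchanged because the first index of [h5] belongs to the later block [y]. *)
rewrite (joint_prob_mass hb)//; congr EFin; rewrite -pair_sumE exchange_big /=.
apply: eq_bigr => y _; rewrite (bigD1 y)//= joint_prod_diag//; last lia.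
by rewrite add0r; apply: eq_bigr => x xy; apply: (joint_prod_beyond hb).
Qed.

End distance_formulas.

(** * Moments *)

Section nat_valued.
Context (R : realType) (d : measure_display) (T : measurableType d)
  (P : probability T R).

Lemma measurable_fun_nat_comp d' (T' : measurableType d') (N : T -> nat)
    (f : nat -> T') :
  (forall i, measurable (N @^-1` [set i])) -> measurable_fun setT (f \o N).
Proof.
move=> mN _ U mU; rewrite setTI.
rewrite (_ : _ @^-1` U = \bigcup_(i in f @^-1` U) (N @^-1` [set i])).
  by apply: bigcup_measurable => i _; exact: mN.
apply/seteqP; split => t /=; first by move=> Ut; exists (N t).
by case=> i /= Ui ->.
Qed.

(** The fibres of [N] partition [D] into countably many pieces, and the integral of a nonnegative
    function is countably additive. *)
Lemma ge0_integral_nat_fibers (D : set T) (F : T -> \bar R) (N : T -> nat) :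
    measurable D -> measurable_fun D F -> (forall t, (0 <= F t)%E) ->
    (forall i, measurable (N @^-1` [set i])) ->
  (\int[P]_(t in D) F t =
   \sum_(i <oo) \int[P]_(t in D `&` N @^-1` [set i]) F t)%E.
Proof.
move=> mD mF F0 mN.
have DE : D = \bigcup_i (D `&` N @^-1` [set i]).
  by apply/seteqP; split => t /=; [move=> Dt; exists (N t) | case=> i _ []].
rewrite {1}DE ge0_integral_bigcup //.
- by move=> i; exact: measurableI.
- by rewrite -DE.
- by move=> i j _ _ [t [[_ /= <-] [_ /= <-]]].
Qed.

Lemma ge0_integral_nat (D : set T) (N : T -> nat) (f : nat -> R) :
    measurable D -> (forall i, 0 <= f i) ->
    (forall i, measurable (N @^-1` [set i])) ->
  (\int[P]_(t in D) (f (N t))%:E =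
   \sum_(i <oo) (f i)%:E * P (D `&` N @^-1` [set i]))%E.
Proof.
move=> mD f0 mN; rewrite (ge0_integral_nat_fibers (N := N))//; last 2 first.
- apply: measurable_funTS; apply/measurable_EFinP.
  exact: measurable_fun_nat_comp.
- by move=> t; rewrite lee_fin.
apply: eq_eseriesr => i _.
rewrite -(integral_cst P (measurableI _ _ mD (mN i)) (f i)%:E).
by apply: eq_integral => t; rewrite inE /= => -[_ ->].
Qed.

Lemma ge0_expectation_nat (N : T -> nat) (f : nat -> R) :
    (forall i, 0 <= f i) -> (forall i, measurable (N @^-1` [set i])) ->
  ('E_P[f \o N] = \sum_(i <oo) (f i)%:E * P (N @^-1` [set i]))%E.
Proof.
move=> f0 mN; rewrite unlock ge0_integral_nat//.
by apply: eq_eseriesr => i _; rewrite setTI.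
Qed.

(** Cut along the fibres of [N] first; on each of them only [M] still varies. *)
Lemma ge0_expectation_nat2 (N M : T -> nat) (f h : nat -> R) :
    (forall i, 0 <= f i) -> (forall i, 0 <= h i) ->
    (forall i, measurable (N @^-1` [set i])) ->
    (forall i, measurable (M @^-1` [set i])) ->
  ('E_P[(f \o N) * (h \o M)] = \sum_(i <oo) \sum_(j <oo)
     (f i * h j)%:E * P (N @^-1` [set i] `&` M @^-1` [set j]))%E.
Proof.
move=> f0 h0 mN mM; rewrite unlock (ge0_integral_nat_fibers (N := N))//;
  last 2 first.
- apply/measurable_EFinP/measurable_funM.
    exact: measurable_fun_nat_comp.
  exact: measurable_fun_nat_comp.
- by move=> t; rewrite lee_fin; exact: (mulr_ge0 (f0 _) (h0 _)).
apply: eq_eseriesr => i _; rewrite setTI.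
rewrite -(ge0_integral_nat (f := fun j => f i * h j))//; last first.
  by move=> j; rewrite mulr_ge0.
by apply: eq_integral => t; rewrite inE /= => <-.
Qed.

(** The norm of exponent 2 is a power of the integral of [|X|^2], hence finite with it. *)
Lemma expectation_sqr_Lfun2 (X : T -> R) : measurable_fun setT X ->
  ('E_P[X ^+ 2] < +oo)%E -> X \in Lfun P 2%:E.
Proof.
move=> mX X2; rewrite inE; apply/andP; split; rewrite inE//=.
rewrite /finite_norm unlock /Lnorm poweR_lty//.
move: X2; rewrite unlock; congr (_ < _)%E; apply: eq_integral => t _.
rewrite /= (_ : (`|X t| `^ 2)%R = `|X t| ^+ 2); last by rewrite -powR_mulrn.
by rewrite -normrX ger0_norm ?sqr_ge0// expr2.
Qed.

End nat_valued.

(** * The logarithmic series and geometric domination of quadratic growth *)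

Section log_series.
Import numFieldNormedType.Exports.
Context (R : realType).
Implicit Types (x y a w : R).

Lemma is_derive_sum_powers n y :
  is_derive y 1 (fun t : R => \sum_(1 <= j < n.+1) j%:R^-1 * t ^+ j)
    (\sum_(0 <= j < n) y ^+ j).
Proof.
elim: n => [|n IH].
  rewrite (_ : (fun _ => _) = cst 0); last by apply/funext => t;
    rewrite big_geq.
  by rewrite big_geq//; exact: is_derive_cst.
rewrite (_ : (fun _ => _) = (fun t : R => \sum_(1 <= j < n.+1) j%:R^-1 * t ^+ j)
    + (n.+1%:R^-1 \*: (@id R) ^+ n.+1)); last first.
  by apply/funext => t; rewrite big_nat_recr//= !fctE.
have /is_derive_eq := is_deriveD IH (is_deriveZ n.+1%:R^-1 (is_deriveX n.+1
  (is_derive_id y 1))).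
apply; rewrite big_nat_recr//=; congr (_ + _).
by rewrite /GRing.scale /= mulr1 mulrA mulVf ?mul1r// pnatr_eq0.
Qed.

(* The remainder of the logarithmic series has derivative [y^n / (1 - y)]. *)
Lemma ln1B_remainder n x : 0 <= x < 1 ->
  0 <= - ln (1 - x) - \sum_(1 <= j < n.+1) j%:R^-1 * x ^+ j <= x ^+ n / (1 - x).
Proof.
move=> /andP[x0 x1].
pose f (t : R) := - ln (1 - t) - \sum_(1 <= j < n.+1) j%:R^-1 * t ^+ j.
have df y : y < 1 -> is_derive y 1 f (y ^+ n / (1 - y)).
  move=> y1; have y1' : 0 < 1 - y by rewrite subr_gt0.
  have dl : is_derive y 1 (fun t : R => ln (1 - t)) ((1 - y)^-1 * (- 1)).
    apply: (@is_derive1_comp _ (@ln R) (fun t => 1 - t)).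
      exact: is_derive1_ln.
    have := is_deriveB (is_derive_cst (1 : R) y 1) (is_derive_id y 1).
    by rewrite sub0r.
  have := is_deriveB (is_deriveN dl) (is_derive_sum_powers n y).
  rewrite (_ : - _ - _ = y ^+ n / (1 - y)) //.
  have : (1 - y) * \sum_(0 <= j < n) y ^+ j = 1 - y ^+ n.
    by rewrite -[1 in RHS](expr1n _ n) subrXX big_mkord; congr (_ * _);
      apply: eq_bigr => i _; rewrite expr1n mul1r.
  move: (\sum_(0 <= j < n) _) => s E.
  apply: (mulfI (lt0r_neq0 y1')); rewrite mulrBr E.
  by field; rewrite lt0r_neq0.
(* The mean value theorem gives [f x = c^n / (1 - c) * x] with [0 <= c <= x < 1]; the bound follows
   by dropping the factor [x] and replacing [c] by [x]. *)
have [| |c /itvP cx fx] := @MVT_segment R f (fun y => y ^+ n / (1 - y)) 0 x x0.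
- by move=> t /itvP tx; apply: df; rewrite (lt_trans _ x1)// tx.
- apply: derivable_within_continuous => t /itvP tx.
  have t1 : t < 1 by rewrite (le_lt_trans _ x1)// tx.
  by have [] := df t t1.
have f0 : f 0 = 0.
  rewrite /f subr0 ln1 oppr0 sub0r big_nat big1 ?oppr0// => i /andP[i0 _].
  by rewrite expr0n eqn0Ngt i0 mulr0.
have fE : f x = c ^+ n /
  (1 - c) * x by rewrite -[LHS]subr0 -[X in _ - X]f0 fx subr0.
rewrite -/(f x) fE.
have c0 : 0 <= c by rewrite cx.
have cx' : c <= x by rewrite cx.
have x1' : 0 < 1 - x by rewrite subr_gt0.
have c1' : 0 < 1 - c by rewrite subr_gt0 (le_lt_trans cx').
have fc0 : 0 <= c ^+ n / (1 - c) by rewrite divr_ge0 ?exprn_ge0// ltW.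
rewrite mulr_ge0//=.
rewrite (@le_trans _ _ (c ^+ n / (1 - c)))//; first by rewrite ler_piMr// ltW.
rewrite ler_pM ?exprn_ge0 ?invr_ge0 ?(ltW c1')//;
  first by rewrite lerXn2r ?nnegrE.
by rewrite lef_pV2 ?posrE// lerD2l lerN2.
Qed.

Lemma cvg_ln1B_series x : 0 <= x < 1 ->
  (fun n => \sum_(1 <= j < n.+1) j%:R^-1 * x ^+ j) @ \oo --> - ln (1 - x).
Proof.
move=> x01; have /andP[x0 x1] := x01.
have x1' : 0 < 1 - x by rewrite subr_gt0.
apply/cvgrPdist_le => e e0.
have /cvgrPdist_le /(_ _ e0) : (fun n => geometric (1 - x)^-1 x n) @ \oo -->
  (0 : R).
  by apply: cvg_geometric; rewrite ger0_norm.
apply: filterS => n; rewrite sub0r normrN /geometric /= => He.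
have /andP[r0 r1] := ln1B_remainder n x01.
rewrite ger0_norm// (le_trans r1)//.
by rewrite (le_trans _ He)// mulrC ler_norm.
Qed.

Lemma sqr_expr_bound a : 0 < a < 1 ->
  exists C rho : R, [/\ 0 <= C, 0 < rho < 1 &
    forall N, N%:R ^+ 2 * a ^+ N <= C * rho ^+ N].
Proof.
move=> /andP[a0 a1]; have [e [e0 aE]] : exists e : R, 0 < e /\ a = 1 - 2 * e.
  by exists ((1 - a) / 2); split; [lra | field].
(* Writing [a = 1 - 2e] makes [(1 + e)^2 * a = 1 - 3e^2 - 2e^3] smaller than [1]. The constant comes
   from squaring the Bernoulli-type bound [e * N <= (1 + e)^N]. *)
exists (e ^- 2), ((1 + e) ^+ 2 * a); split.
- by rewrite invr_ge0 sqr_ge0.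
- rewrite mulr_gt0 ?exprn_gt0 ?addr_gt0//=.
  rewrite (_ : _ * a = 1 - e ^+ 2 * (1 + (1 + e) *+ 2)); last first.
    by rewrite aE; ring.
  by rewrite gtrBl mulr_gt0 ?exprn_gt0// ltr_wpDr// mulrn_wge0 ?addr_ge0// ltW.
move=> N; rewrite exprMn mulrA ler_pM2r ?exprn_gt0//.
rewrite -ler_pdivrMl ?invr_gt0 ?exprn_gt0// invrK -exprMn -exprM mulnC exprM.
rewrite lerXn2r ?nnegrE ?mulr_ge0 ?(ltW e0)//.
  by rewrite exprn_ge0// addr_ge0// ltW.
elim: N => [|N IH]; first by rewrite mulr0 expr0.
rewrite exprS -natr1; set X := (1 + e) ^+ N in IH *.
have : 1 <= X by rewrite exprn_ege1// lerDl ltW.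
nra.
Qed.

End log_series.

(** * Sums of [g] and of its square against a geometric law *)

Section g_sums.
Import numFieldNormedType.Exports.
Context (R : realType).
Implicit Types w : R.

Let ln2_gt0 : 0 < ln 2 :> R.
Proof. by rewrite ln_gt0// ltr1n. Qed.

Lemma g_ge0 i : 0 <= g R i.
Proof.
by rewrite mulr_ge0 ?invr_ge0 ?(ltW ln2_gt0)// sumr_ge0// => j _;
  rewrite invr_ge0.
Qed.

Lemma g_eq0 i : (i <= 1)%N -> g R i = 0.
Proof. by move=> i1; rewrite /g big_geq// mulr0. Qed.

Lemma gS i : (0 < i)%N -> g R i.+1 = g R i + (ln 2)^-1 * i%:R^-1.
Proof. by move=> i0; rewrite /g big_nat_recr//= mulrDr. Qed.

Lemma g_le i : g R i.+1 <= (ln 2)^-1 * i%:R.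
Proof.
case: i => [|i]; first by rewrite g_eq0// mulr0.
elim: i => [|i IH]; first by rewrite gS// g_eq0// add0r invr1.
rewrite gS//.
have -> : (ln 2)^-1 * i.+2%:R = (ln 2)^-1 * i.+1%:R + (ln 2)^-1 :> R.
  by rewrite -[i.+2%:R]natr1 mulrDr mulr1.
apply: lerD IH _; rewrite ler_piMr ?invr_ge0 ?(ltW ln2_gt0)//.
by rewrite invf_le1 ?ler1n ?ltr0n.
Qed.

(** Summation by parts: [w * (1 - w)^(i-1)] is the difference [(1 - w)^(i-1) - (1 - w)^i], and [g]
    increases by [1 / (i * ln 2)] from [i] to [i + 1]. *)
Lemma sum_g_geometric N w :
  \sum_(1 <= i < N.+2) g R i * (w * (1 - w) ^+ (i - 1)) =
  (ln 2)^-1 * (\sum_(1 <= j < N.+1) j%:R^-1 * (1 - w) ^+ j) -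
  g R N.+1 * (1 - w) ^+ N.+1.
Proof.
elim: N => [|N IH];
  first by rewrite big_nat1 big_geq// g_eq0// !mul0r mulr0 subr0.
rewrite big_nat_recr//= IH [in RHS]big_nat_recr//= subn1 (gS (ltn0Sn N)).
rewrite [N.+2.-1]/= [(1 - w) ^+ N.+2]exprS; move: (_ ^+ N.+1) => X.
ring.
Qed.

Lemma cvg_sum_g w : 0 < w < 1 ->
  (fun N => \sum_(1 <= i < N.+2) g R i * (w * (1 - w) ^+ (i - 1))) @ \oo
    --> - log2 w.
Proof.
move=> /andP[w0 w1].
under eq_fun do rewrite sum_g_geometric.
have -> : - log2 w = (ln 2)^-1 * - ln (1 - (1 - w)) - 0.
  by rewrite subKr /log2 subr0 mulrN mulrC.
have w'01 : 0 <= 1 - w < 1 by apply/andP; split; lra.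
apply: cvgB; first exact: cvgMr (cvg_ln1B_series w'01).
have w'01' : 0 < 1 - w < 1 by apply/andP; split; lra.
(* The quadratic bound makes the boundary term vanish, as [g (n + 1)] is at most [n / ln 2] and
   [n <= (n + 1)^2]. *)
have [C [rho [C0 /andP[r0 r1] H]]] := sqr_expr_bound w'01'.
apply: (@squeeze_cvgr _ _ _ _ (fun=> 0)
  (fun n => geometric ((ln 2)^-1 * C * rho) rho n)).
- near=> n; rewrite mulr_ge0 ?g_ge0 ?exprn_ge0//=; last lra.
  have -> : (ln 2)^-1 * C * rho * rho ^+ n = (ln 2)^-1 * (C * rho ^+ n.+1).
    by rewrite exprS !mulrA.
  have i0 : 0 <= (ln 2)^-1 :> R by rewrite invr_ge0 ltW.
  apply: le_trans (ler_wpM2l i0 (H n.+1)); rewrite mulrA.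
  apply: ler_wpM2r; first by rewrite exprn_ge0; lra.
  apply: (le_trans (g_le n)); apply: ler_wpM2l => //.
  by rewrite -natrX ler_nat; lia.
- exact: cvg_cst.
- by apply: cvg_geometric; rewrite ger0_norm// ltW.
Unshelve. all: by end_near. Qed.

Lemma sum_g_sqr_bounded w : 0 < w < 1 -> exists M : R, forall N,
  \sum_(1 <= i < N) g R i ^+ 2 * (1 - w) ^+ (i - 1) <= M.
Proof.
move=> /andP[w0 w1].
have w'01 : 0 < 1 - w < 1 by apply/andP; split; lra.
have [C [rho [C0 /andP[r0 r1] H]]] := sqr_expr_bound w'01.
exists ((ln 2)^-1 ^+ 2 * C / (1 - rho)) => -[|N].
  rewrite big_geq//; apply: divr_ge0; last lra.
  by apply: mulr_ge0; rewrite // sqr_ge0.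
rewrite big_add1 /=;
  apply: (@le_trans _ _ (\sum_(0 <= i < N) (ln 2)^-1 ^+ 2 * C * rho ^+ i)).
  apply: ler_sum => i _; rewrite subn1 /= -mulrA.
  apply: (le_trans _ (ler_wpM2l _ (H i))); last by rewrite sqr_ge0.
  rewrite mulrA -exprMn ler_wpM2r ?exprn_ge0//; first lra.
  by rewrite lerXn2r ?nnegrE ?g_ge0 ?g_le// mulr_ge0 ?invr_ge0 ?(ltW ln2_gt0).
rewrite -mulr_sumr; apply: ler_wpM2l.
  by apply: mulr_ge0; rewrite // sqr_ge0.
have r1' : 0 < 1 - rho by rewrite subr_gt0.
rewrite -[leRHS]mul1r ler_pdivlMr// [leLHS]mulrC.
have -> : (1 - rho) * \sum_(0 <= i < N) rho ^+ i = 1 - rho ^+ N.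
  rewrite -[1 in RHS](expr1n _ N) subrXX big_mkord; congr (_ * _).
  by apply: eq_bigr => i _; rewrite expr1n mul1r.
by rewrite gerBl exprn_ge0// ltW.
Qed.

End g_sums.

(** * Moment series of the distance and the entropy of a block *)

Section moments.
Import numFieldNormedType.Exports.
Context (R : realType) (d : measure_display) (T : measurableType d)
  (P : probability T R) (L : nat) (p : R)
  (b : int -> {mfun T >-> L.-tuple bool}).
Context (L0 : (0 < L)%N) (p01 : 0 < p < 1) (hb : iid_bernoulli_blocks P p b).

(** The strict upper bound comes from [p ^+ r] when [r > 0], and from [(1 - p) ^+ L] with [L > 0]
    when [r = 0]. *)
Lemma w_itv r : (r <= L)%N -> 0 < w L p r < 1.
Proof.
have /andP[p0 p1] := p01; have p1' : 0 < 1 - p by rewrite subr_gt0.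
have p1'' : 1 - p < 1 by rewrite ltrBlDr ltrDl.
move=> rL; rewrite /w mulr_gt0 ?exprn_gt0//=.
case: r rL => [|r] rL.
  by rewrite expr0 mul1r subn0 exprn_ilt1// ?ltW// -lt0n.
rewrite (@le_lt_trans _ _ (p ^+ r.+1))//; last by rewrite exprn_ilt1// ltW.
by rewrite ler_piMr ?exprn_ge0 ?exprn_ile1// ltW.
Qed.

Lemma sum_binomial_w : \sum_(r < L.+1) 'C(L, r)%:R * w L p r = 1.
Proof. by rewrite -sum_ones_ring -(block_massT hb). Qed.

(** Linearity of the mean: the number of ones is a sum of [L] bits, each of mean [p]. *)
Lemma sum_binomial_w_mean : \sum_(r < L.+1) 'C(L, r)%:R * (w L p r * r%:R) =
  L%:R * p.
Proof.
rewrite -(sum_ones_ring L (fun r => w L p r * r%:R)).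
transitivity (\sum_(x : L.-tuple bool)
  \sum_(l < L) w L p (ones x) * (tnth x l)%:R).
  by apply: eq_bigr => x _;
    rewrite [in LHS](ones_sum x) natr_sum mulr_sumr -ones_sum.
rewrite exchange_big /= (eq_bigr (fun=> p)) => [|l _].
  by rewrite sumr_const card_ord mulr_natl.
have [_ _ hp] := hb; apply: EFin_inj; rewrite -(hp 0 l).
rewrite [RHS](prob_block_in hb 0 (fun z => tnth z l)).
rewrite /block_mass [in RHS]big_mkcond; congr EFin.
by apply: eq_bigr => x _; case: (tnth x l); rewrite ?mulr1 ?mulr0.
Qed.

(** [log2 (w L p r)] is affine in [r], so only the total mass and the mean number of ones enter. *)
Lemma sum_binomial_w_log2 :
  \sum_(r < L.+1) 'C(L, r)%:R * (w L p r * - log2 (w L p r))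
    = L%:R * bit_entropy p.
Proof.
have /andP[p0 p1] := p01; have p1' : 0 < 1 - p by rewrite subr_gt0.
rewrite (eq_bigr (fun r : 'I_L.+1 =>
  (log2 (1 - p) - log2 p) * ('C(L, r)%:R * (w L p r * r%:R)) -
  L%:R * log2 (1 - p) * ('C(L, r)%:R * w L p r))) => [|r _].
  rewrite sumrB -!mulr_sumr sum_binomial_w sum_binomial_w_mean /bit_entropy.
  ring.
have rL : (r <= L)%N by rewrite -ltnS.
rewrite {2}/w /log2 lnM ?posrE ?exprn_gt0// !lnXn//
  -(mulr_natr (ln p)) -(mulr_natr (ln (1 - p))) natrB//.
ring.
Qed.

Lemma dist_prob_ge0 n i : (0 <= dist_prob P b n i)%E.
Proof. exact: measure_ge0. Qed.

(** The mixture over [r] is finite, so the limit is taken separately for each [r] and gives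
    [- log2 (w L p r)]. *)
Lemma mean_g_series n :
  (\sum_(1 <= i <oo) (g R i)%:E * dist_prob P b n i =
    (L%:R * bit_entropy p)%:E)%E.
Proof.
apply/cvg_lim => //; rewrite -(cvg_shiftn 2%N) /=.
have -> : (fun N => \sum_(1 <= i < N + 2) (g R i)%:E * dist_prob P b n i)%E =
   (fun N => (\sum_(r < L.+1) 'C(L, r)%:R * (w L p r *
     (\sum_(1 <= i < N.+2) g R i * (w L p r * (1 - w L p r) ^+ (i - 1)))))%:E).
  apply/funext => N; rewrite addn2.
  rewrite (@eq_big_nat _ _ _ _ _ _ (fun i => (\sum_(r < L.+1) 'C(L, r)%:R *
    (w L p r *
     (g R i * (w L p r * (1 - w L p r) ^+ (i - 1)))))%:E)) => [|i /andP[i0 _]].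
    rewrite sumEFin; congr EFin; rewrite exchange_big /=; apply: eq_bigr => r _.
    by rewrite !mulr_sumr.
  rewrite (dist_probE hb)// -EFinM; congr EFin; rewrite mulr_sumr.
  by apply: eq_bigr => r _; ring.
apply: cvg_EFin; first exact: nearW.
rewrite -sum_binomial_w_log2; apply: cvg_big => [|r _];
  first exact: add_continuous.
apply: cvgMr; apply: cvgMr; apply: cvg_sum_g; apply: w_itv.
by rewrite -ltnS.
Qed.

Lemma second_moment_g_series n :
  (\sum_(1 <= i <oo) (g R i ^+ 2)%:E * dist_prob P b n i < +oo)%E.
Proof.
have wi (r : 'I_L.+1) : 0 < w L p r < 1 by apply: w_itv; rewrite -ltnS.
have [M HM] := choice (fun r : 'I_L.+1 => sum_g_sqr_bounded (wi r)).
apply: (@le_lt_trans _ _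
  (\sum_(r < L.+1) 'C(L, r)%:R * w L p r ^+ 2 * M r)%:E); last exact: ltry.
apply: lime_le.
  by apply: is_cvg_nneseries => i _ _;
    rewrite mule_ge0 ?dist_prob_ge0// lee_fin sqr_ge0.
apply: nearW => N.
rewrite (@eq_big_nat _ _ _ _ _ _ (fun i =>
  (\sum_(r < L.+1) 'C(L, r)%:R * w L p r ^+ 2 *
     (g R i ^+ 2 * (1 - w L p r) ^+ (i - 1)))%:E)) => [|i /andP[i0 _]].
  rewrite sumEFin lee_fin exchange_big /=; apply: ler_sum => r _.
  by rewrite -mulr_sumr ler_wpM2l// mulr_ge0// sqr_ge0.
rewrite (dist_probE hb)// -EFinM; congr EFin; rewrite mulr_sumr.
by apply: eq_bigr => r _; ring.
Qed.

End moments.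

(** * Variance of the mean of a second-order stationary sequence *)

Section stationary_variance.
Context (R : realType) (d : measure_display) (T : measurableType d)
  (P : probability T R) (X : nat -> T -> R) (V : R) (C : nat -> R).
Context (X2 : forall n, (0 < n)%N -> X n \in Lfun P 2%:E)
  (XV : forall n, (0 < n)%N -> 'V_P[X n] = V%:E)
  (XC : forall n k, (0 < n)%N -> (0 < k)%N ->
     covariance P (X n) (X (n + k)) = (C k)%:E).

Let S (K : nat) (t : T) : R := \sum_(1 <= n < K.+1) X n t.

Let S0 : S 0 = cst 0.
Proof. by apply/funext => t; rewrite /S big_geq. Qed.

Let SS K : S K.+1 = S K \+ X K.+1.
Proof. by apply/funext => t; rewrite /S big_nat_recr. Qed.

Let SL2 K : S K \in Lfun P 2%:E.
Proof.
elim: K => [|K IH]; first by rewrite S0 Lfun_cst.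
by rewrite SS rpredD ?lee1n//= ?X2.
Qed.

(** Keeping [m] separate from [K] lets the induction lengthen the sum while the last variable stays
    fixed. *)
Let cov_sum m K : (m <= K)%N ->
  covariance P (S m) (X K.+1) = (\sum_(1 <= n < m.+1) C (K.+1 - n))%:E.
Proof.
elim: m => [_|m IH mK]; first by rewrite S0 covariance_cst_l big_geq.
rewrite SS covarianceDl ?X2// IH ?(ltnW mK)//.
  rewrite [in RHS]big_nat_recr// EFinD; congr (_ + _)%E.
rewrite -(XC (ltn0Sn m)); last by rewrite subn_gt0 ltnS.
by rewrite subnKC // ltnW.
Qed.

(** Adding [X K.+1] contributes [V] and twice the covariances [C 1], ..., [C K], so every
    coefficient [K - k] grows by one. *)
Lemma variance_stationary_sum K :
  'V_P[S K] = (K%:R * V + 2 * \sum_(1 <= k < K) (K%:R - k%:R) * C k)%:E.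
Proof.
elim: K => [|K IH];
  first by rewrite S0 variance_cst big_geq// mul0r mulr0 addr0.
rewrite SS varianceD ?X2// IH XV// cov_sum// -EFinM -!EFinD; congr EFin.
have -> : \sum_(1 <= n < K.+1) C (K.+1 - n)%N = \sum_(1 <= k < K.+1) C k.
  rewrite big_nat_rev /= [RHS]big_nat [LHS]big_nat;
    apply: eq_bigr => n /andP[n0 nK].
  by congr C; lia.
have -> : \sum_(1 <= k < K.+1) (K.+1%:R - k%:R) * C k =
    \sum_(1 <= k < K) (K%:R - k%:R) * C k + \sum_(1 <= k < K.+1) C k :> R.
  (* The range extends to [k = K] at no cost, since the coefficient [K - K] vanishes. *)
  have -> : \sum_(1 <= k < K) (K%:R - k%:R) * C k =
      \sum_(1 <= k < K.+1) (K%:R - k%:R) * C k.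
    case: K {IH} => [|K]; first by rewrite !big_geq.
    by rewrite [RHS]big_nat_recr//= subrr mul0r addr0.
  by rewrite -big_split /=; apply: eq_bigr => k _; rewrite -natr1; ring.
rewrite -natr1; ring.
Qed.

Lemma variance_stationary_mean K : (0 < K)%N ->
  'V_P[fun t => K%:R^-1 * S K t] =
  (K%:R^-1 * V + 2 / K%:R * \sum_(1 <= k < K) (1 - k%:R / K%:R) * C k)%:E.
Proof.
move=> K0; have K0' : K%:R != 0 :> R by rewrite pnatr_eq0 -lt0n.
rewrite (_ : (fun _ => _) = K%:R^-1 \o* S K); last first.
  by apply/funext => t; rewrite /= mulrC.
rewrite varianceZ// variance_stationary_sum -EFinM; congr EFin.
have -> : \sum_(1 <= k < K) (1 - k%:R / K%:R) * C k =
    K%:R^-1 * \sum_(1 <= k < K) (K%:R - k%:R) * C k :> R.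
  by rewrite mulr_sumr; apply: eq_bigr => k _; field.
by field.
Qed.

End stationary_variance.

(** Serves to discard the default distance [0], whose weight [g 0] is zero. *)
Lemma nneseries_from1 (R : realType) (u : nat -> \bar R) :
  (forall i, (0 <= u i)%E) -> u 0%N = 0%E ->
  (\sum_(i <oo) u i = \sum_(1 <= i <oo) u i)%E.
Proof. by move=> u0 uz; rewrite nneseries_recl// uz add0e. Qed.

Lemma eq_eseries1 (R : realType) (u v : nat -> \bar R) :
  (forall i, (0 < i)%N -> u i = v i) ->
  (\sum_(1 <= i <oo) u i = \sum_(1 <= i <oo) v i)%E.
Proof.
move=> uv; apply: congr_lim; apply/funext => n.
by apply: eq_big_nat => i /andP[i0 _]; exact: uv.
Qed.

(** * Mean, variance and covariances of [g] at the distances *)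

Section statistic_moments.
Context (R : realType) (d : measure_display) (T : measurableType d)
  (P : probability T R) (L : nat) (p : R)
  (b : int -> {mfun T >-> L.-tuple bool}).
Context (L0 : (0 < L)%N) (p01 : 0 < p < 1) (hb : iid_bernoulli_blocks P p b).

Let mdist n i : measurable (distance b n%:Z @^-1` [set i]).
Proof. exact: measurable_distance_eq. Qed.

Lemma expectation_g_dist n : ('E_P[g_dist R b n] = (L%:R * bit_entropy p)%:E)%E.
Proof.
rewrite (ge0_expectation_nat P (f := g R) (N := distance b n%:Z))//;
  last exact: g_ge0.
rewrite nneseries_from1; last 2 first.
- by move=> i; rewrite mule_ge0 ?measure_ge0// lee_fin g_ge0.
- by rewrite g_eq0// mul0e.
exact: mean_g_series.
Qed.

Lemma expectation_g_dist_sqr n :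
  ('E_P[g_dist R b n ^+ 2] = \sum_(1 <= i <oo)
    (g R i ^+ 2)%:E * dist_prob P b n i)%E.
Proof.
rewrite (ge0_expectation_nat P (f := fun i => g R i ^+ 2)
  (N := distance b n%:Z))//; last first.
  by move=> i; exact: sqr_ge0.
rewrite nneseries_from1 //.
- by move=> i; rewrite mule_ge0 ?measure_ge0// lee_fin sqr_ge0.
- by rewrite g_eq0// expr0n mul0e.
Qed.

Lemma Lfun2_g_dist n : g_dist R b n \in Lfun P 2%:E.
Proof.
apply: expectation_sqr_Lfun2.
  exact: (measurable_fun_nat_comp (N := distance b n%:Z)).
by rewrite expectation_g_dist_sqr; exact: (second_moment_g_series L0 p01 hb).
Qed.

Lemma variance_g_dist n :
  ('V_P[g_dist R b n] = \sum_(1 <= i <oo) (g R i ^+ 2)%:E * dist_prob P b n i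
     - ((L%:R * bit_entropy p) ^+ 2)%:E)%E.
Proof.
rewrite varianceE; last exact: Lfun2_g_dist.
by rewrite expectation_g_dist expectation_g_dist_sqr EFin_expe.
Qed.

(** Square integrability makes each factor and the product integrable, so the covariance is the mean
    of the product minus the product of the means. *)
Lemma covariance_g_dist n k :
  (covariance P (g_dist R b n) (g_dist R b (n + k)) =
     \sum_(1 <= i <oo) \sum_(1 <= j <oo)
       (g R i * g R j)%:E * joint_prob P b n k i j
     - ((L%:R * bit_entropy p) ^+ 2)%:E)%E.
Proof.
have Pfin : P setT \is a fin_num := fin_num_measure P _ measurableT.
rewrite covarianceE; last 3 first.
- exact: (Lfun_subset12 Pfin (Lfun2_g_dist _)).
- exact: (Lfun_subset12 Pfin (Lfun2_g_dist _)).
- exact: (Lfun2_mul_Lfun1 (Lfun2_g_dist _) (Lfun2_g_dist _)).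
rewrite !expectation_g_dist -EFinM -expr2; congr (_ - _)%E.
rewrite (ge0_expectation_nat2 P (N := distance b n%:Z)
  (M := distance b (n + k)%N%:Z) (f := g R) (h := g R))//;
  [|exact: g_ge0|exact: g_ge0].
have term_ge0 i j : (0 <= (g R i * g R j)%:E * joint_prob P b n k i j)%E.
  by rewrite mule_ge0 ?measure_ge0// lee_fin mulr_ge0 ?g_ge0.
rewrite nneseries_from1; last 2 first.
- by move=> i; apply: nneseries_ge0 => j _ _; exact: term_ge0.
- by apply: eseries0 => j _ _; rewrite g_eq0// mul0r mul0e.
apply: eq_eseries1 => i _; rewrite nneseries_from1//.
by rewrite (@g_eq0 R 0%N)// mulr0 mul0e.
Qed.

End statistic_moments.

Theorem mainTheorem1 (R : realType) (d : measure_display)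
    (T : measurableType d) (P : probability T R) (L : nat) (p : R)
    (b : int -> {mfun T >-> L.-tuple bool}) :
  (1 <= L)%N -> 0 < p < 1 -> iid_bernoulli_blocks P p b ->
  (forall n i : nat, (1 <= n)%N -> (1 <= i)%N ->
     dist_prob P b n i =
       (\sum_(r < L.+1) 'C(L, r)%:R * w L p r ^+ 2 *
          (1 - w L p r) ^+ (i - 1))%:E)
  /\
  (forall n n' k i j : nat, (1 <= n)%N -> (1 <= n')%N ->
     (1 <= k)%N -> (1 <= i)%N -> (1 <= j)%N ->
     joint_prob P b n k i j = joint_prob P b n' k i j)
  /\
  (forall n k i j : nat, (1 <= n)%N ->
     (1 <= k)%N -> (1 <= i)%N -> (1 <= j)%N ->
     [/\ (j <= k - 1)%N ->
           joint_prob P b n k i j =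
             ((\sum_(r < L.+1) 'C(L, r)%:R * w L p r ^+ 2 *
                 (1 - w L p r) ^+ (i - 1)) *
              (\sum_(r < L.+1) 'C(L, r)%:R * w L p r ^+ 2 *
                 (1 - w L p r) ^+ (j - 1)))%:E,
         j = k ->
           joint_prob P b n k i j =
             (\sum_(r < L.+1) 'C(L, r)%:R * w L p r ^+ 3 *
                (1 - w L p r) ^+ (i + k - 2))%:E,
         (k + 1 <= j <= k + i - 1)%N ->
           joint_prob P b n k i j = (pair_sum L (h3 L p k i j))%:E,
         j = (k + i)%N ->
           joint_prob P b n k i j = 0%E
       & (k + i + 1 <= j)%N ->
           joint_prob P b n k i j = (pair_sum L (h5 L p k i j))%:E])
  /\
  (exists (V : R) (C : nat -> R),
     [/\ forall n : nat, (1 <= n)%N ->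
           V%:E = 'V_P[g_dist R b n] /\
           V%:E = (\sum_(1 <= i <oo) ((g R i) ^+ 2)%:E * dist_prob P b n i
                   - ((L%:R * bit_entropy p) ^+ 2)%:E)%E,
         forall n k : nat, (1 <= n)%N -> (1 <= k)%N ->
           (C k)%:E = covariance P (g_dist R b n) (g_dist R b (n + k)) /\
           (C k)%:E = (\sum_(1 <= i <oo) \sum_(1 <= j <oo)
                         (g R i * g R j)%:E * joint_prob P b n k i j
                       - ((L%:R * bit_entropy p) ^+ 2)%:E)%E
       & forall K : nat, (1 <= K)%N ->
           'V_P[coron_stat R b K] =
             (K%:R^-1 * V +
              2 / K%:R * \sum_(1 <= k < K) (1 - k%:R / K%:R) * C k)%:E]).
Proof.
move=> L0 p01 hb.
(* The series depend on [n] only through probabilities that do not, so time [1] serves as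
   reference. *)
have varE n : 'V_P[g_dist R b n] = 'V_P[g_dist R b 1].
  rewrite !(variance_g_dist L0 p01 hb); congr (_ - _)%E.
  by apply: eq_eseries1 => i i0; rewrite !(dist_probE hb).
have covE n k : covariance P (g_dist R b n) (g_dist R b (n + k)) =
    covariance P (g_dist R b 1) (g_dist R b (1 + k)).
  rewrite !(covariance_g_dist L0 p01 hb); congr (_ - _)%E.
  apply: eq_eseries1 => i i0; apply: eq_eseries1 => j j0.
  by rewrite (joint_prob_stationary hb n 1).
have X2 := Lfun2_g_dist L0 p01 hb.
have Pfin : P setT \is a fin_num := fin_num_measure P _ measurableT.
have covfin n m : covariance P (g_dist R b n) (g_dist R b m) \is a fin_num.
  by apply: covariance_fin_num;
    rewrite ?(Lfun_subset12 Pfin (X2 _)) ?(Lfun2_mul_Lfun1 (X2 _) (X2 _)).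
split; [|split; [|split]].
- by move=> n i _ i0; exact: (dist_probE hb).
- by move=> n n' k i j _ _ _ i0 j0; exact: (joint_prob_stationary hb).
- move=> n k i j _ k0 i0 j0; split => [jk|->|/andP[kj ji]|->|ij].
  + by apply: (joint_prob_before hb) => //; lia.
  + exact: (joint_prob_at hb).
  + by apply: (joint_prob_inside hb) => //; lia.
  + exact: (joint_prob_same_start hb).
  + by apply: (joint_prob_beyond hb) => //; lia.
(* Square integrability makes these extended reals finite, so [fine] loses nothing. *)
pose V := fine 'V_P[g_dist R b 1].
pose C k := fine (covariance P (g_dist R b 1) (g_dist R b (1 + k))).
have VE n : 'V_P[g_dist R b n] = V%:E.
  by rewrite varE fineK// variance_fin_num.
have CE n k : covariance P (g_dist R b n) (g_dist R b (n + k)) = (C k)%:E.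
  by rewrite covE fineK.
exists V, C; split.
- by move=> n _; rewrite -(VE n); split => //;
    exact: (variance_g_dist L0 p01 hb).
- by move=> n k _ _; rewrite -(CE n k); split => //;
    exact: (covariance_g_dist L0 p01 hb).
- by move=> K K0; apply: (variance_stationary_mean (X := g_dist R b)).
Qed.
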